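(* Let $G$ be an affine algebraic group over $\Bbbk$ whose identity component is a torus $T$, and let $g\in G$. Let $\varphi_g:T\to T$ be the automorphism $t\mapsto g^{-1}tg$. If the connected component $gT$ is periodic, then the order of every element of $gT$ divides $mk$, where $m$ is the order of the automorphism $\varphi_g$ and $k$ is the order of $gT$ in the group $G/T$.
   Context: $\Bbbk$ is an algebraically closed field of characteristic zero. A connected component of an affine algebraic group is called periodic if all its elements have finite order. *)

(* Defs.v *)
From HB Require Import structures.
From mathcomp Require Import all_boot all_algebra.
From mathcomp Require Import boolp classical_sets topology_structure connected.
(* The notations of mpoly clash with those of mathcomp-analysis. *)
From mathcomp Require Import -(notations) mpoly.

Set Implicit Arguments.
Unset Strict Implicit.
Unset Printing Implicit Defensive.

Import GRing.Theory.

Local Open Scope classical_set_scope.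
Local Open Scope group_scope.

(* An alias of K^n, so that the Zariski topology attached to it below cannot
   interfere with other topologies on finite functions. *)
Definition affine_space (K : fieldType) (n : nat) : Type := {ffun 'I_n -> K}.
HB.instance Definition _ K n := Choice.on (affine_space K n).
Definition affine_coord K n (v : affine_space K n) : 'I_n -> K :=
  (v : {ffun 'I_n -> K}).
Coercion affine_coord : affine_space >-> Funclass.

Definition affine_pair K m n (v : affine_space K m) (w : affine_space K n) :
    affine_space K (m + n) :=
  [ffun i => match split i with inl j => v j | inr j => w j end].

Lemma affine_pairl K m n (v : affine_space K m) (w : affine_space K n) i :
  affine_pair v w (lshift n i) = v i.
Proof. by rewrite /affine_coord ffunE (unsplitK (inl i)). Qed.

Lemma affine_pairr K m n (v : affine_space K m) (w : affine_space K n) i :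
  affine_pair v w (rshift m i) = w i.
Proof. by rewrite /affine_coord ffunE (unsplitK (inr i)). Qed.

Section Zariski.
Variables (K : fieldType) (n : nat).

Definition zero_locus (I : set (mpoly n K)) : set (affine_space K n) :=
  [set v | forall p, I p -> meval v p = 0%R].

Definition zariski_open : set_system (affine_space K n) :=
  [set U | exists I, U = ~` zero_locus I].

Lemma zariski_openT : zariski_open setT.
Proof.
exists [set p : mpoly n K | p = 1%R]; apply/seteqP; split => // v _ /(_ _ erefl) /eqP.
by rewrite meval1 oner_eq0.
Qed.

Lemma zariski_openI : setI_closed zariski_open.
Proof.
move=> _ _ [I ->] [J ->].
exists [set r | exists p q, [/\ I p, J q & r = (p * q)%R]].
apply/seteqP; split => v /=.
  move=> [/existsNP[p /not_implyP[Ip /eqP pv]]].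
  move=> /existsNP[q /not_implyP[Jq /eqP qv]] /(_ (p * q)%R) h.
  have /eqP : meval v (p * q)%R = 0%R by apply: h; exists p, q.
  by rewrite mevalM mulf_eq0 (negbTE pv) (negbTE qv).
move=> h; split => hI; apply: h => _ [p [q [Ip Jq ->]]]; rewrite mevalM.
  by rewrite (hI _ Ip) mul0r.
by rewrite (hI _ Jq) mulr0.
Qed.

Lemma zariski_open_bigU (T : Type) (f : T -> set (affine_space K n)) :
  (forall i, zariski_open (f i)) -> zariski_open (\bigcup_i f i).
Proof.
move=> /choice[I fI]; exists [set p | exists i, I i p].
apply/seteqP; split => v /=.
  by move=> [i _]; rewrite fI => nIv h; apply: nIv => p Ip; apply: h; exists i.
move=> /existsNP[p /not_implyP[[i Iip] pv]].
by exists i => //; rewrite fI => /(_ p Iip).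
Qed.

HB.instance Definition _ := isOpenTopological.Build (affine_space K n)
  zariski_openT zariski_openI zariski_open_bigU.

Lemma zero_locus_closed (I : set (mpoly n K)) : closed (zero_locus I).
Proof. by rewrite -openC; exists I. Qed.

End Zariski.

(* An affine algebraic group in the classical sense: an abstract group together
   with an identification of its underlying set with a Zariski closed subset of
   an affine space, for which multiplication and inversion are polynomial.  Over
   an algebraically closed field of characteristic zero group schemes of finite
   type are reduced, so that nothing is lost by working with points. *)
HB.mixin Record isAffineAlgGroup (K : fieldType) G of Group G := {
  coord_dim : nat;
  aff_coord : G -> affine_space K coord_dim;
  coord_inj : injective aff_coord;
  closed_coord : closed (range aff_coord);
  mulg_polynomial :
    exists P : 'I_coord_dim -> mpoly (coord_dim + coord_dim) K,
      forall x y i, aff_coord (x * y) i =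
        meval (affine_pair (aff_coord x) (aff_coord y)) (P i);
  invg_polynomial : exists P : 'I_coord_dim -> mpoly coord_dim K,
    forall x i, aff_coord x^-1 i = meval (aff_coord x) (P i)
}.

#[short(type="affAlgGroupType")]
HB.structure Definition AffineAlgGroup (K : fieldType) :=
  {G of isAffineAlgGroup K G & Group G}.

Section AlgebraicMaps.
Variable K : fieldType.

(* Regular functions on a closed subset S of G: restrictions of polynomials in
   the coordinates. *)
Definition regular_on (G : affAlgGroupType K) (S : set G) (f : G -> K) :=
  exists p : mpoly (@coord_dim K G) K,
    forall x, S x -> f x = meval (aff_coord x) p.

Definition regular_map_on (G H : affAlgGroupType K) (S : set G) (f : G -> H) :=
  forall i, regular_on S (fun x => aff_coord (f x) i).

End AlgebraicMaps.

Local Notation mvar i := (mpolyX _ (mnm1 i)).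

Section SplitTorus.
Variables (K : fieldType) (r : nat).

Record split_torus := SplitTorus {
  torus_val : {ffun 'I_r -> K};
  _ : [forall i, torus_val i != 0%R]
}.
HB.instance Definition _ := [isSub for torus_val].
HB.instance Definition _ := [Choice of split_torus by <:].

Implicit Types x y z : split_torus.

Lemma split_torus_neq0 x i : torus_val x i != 0%R.
Proof. exact: (forallP (valP x)). Qed.

Fact split_torus_one_subproof : [forall i, ([ffun=> 1%R] : {ffun 'I_r -> K}) i != 0%R].
Proof. by apply/forallP => i; rewrite ffunE oner_neq0. Qed.

Fact split_torus_mul_subproof x y :
  [forall i, [ffun i => (torus_val x i * torus_val y i)%R] i != 0%R].
Proof. by apply/forallP => i; rewrite ffunE mulf_neq0 ?split_torus_neq0. Qed.

Fact split_torus_inv_subproof x : [forall i, [ffun i => (torus_val x i)^-1%R] i != 0%R].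
Proof. by apply/forallP => i; rewrite ffunE invr_neq0 ?split_torus_neq0. Qed.

Definition split_torus_one : split_torus := SplitTorus split_torus_one_subproof.
Definition split_torus_mul x y : split_torus := SplitTorus (split_torus_mul_subproof x y).
Definition split_torus_inv x : split_torus := SplitTorus (split_torus_inv_subproof x).

Fact split_torus_mulA : associative split_torus_mul.
Proof.
by move=> x y z; apply/val_inj/ffunP => i; rewrite !(SubK, ffunE) mulrA.
Qed.

Fact split_torus_mul1 : left_id split_torus_one split_torus_mul.
Proof. by move=> x; apply/val_inj/ffunP => i; rewrite !(SubK, ffunE) mul1r. Qed.

Fact split_torus_mulr1 : right_id split_torus_one split_torus_mul.
Proof. by move=> x; apply/val_inj/ffunP => i; rewrite !(SubK, ffunE) mulr1. Qed.

Fact split_torus_mulV :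
  left_inverse split_torus_one split_torus_inv split_torus_mul.
Proof.
move=> x; apply/val_inj/ffunP => i.
by rewrite !(SubK, ffunE) mulVf ?split_torus_neq0.
Qed.

Fact split_torus_mulrV :
  right_inverse split_torus_one split_torus_inv split_torus_mul.
Proof.
move=> x; apply/val_inj/ffunP => i.
by rewrite !(SubK, ffunE) mulfV ?split_torus_neq0.
Qed.

HB.instance Definition _ := isGroup.Build split_torus
  split_torus_mulA split_torus_mul1 split_torus_mulr1
  split_torus_mulV split_torus_mulrV.

Lemma split_torusM x y i : torus_val (x * y) i = (torus_val x i * torus_val y i)%R.
Proof. by rewrite /mul /= ffunE. Qed.

Lemma split_torusV x i : torus_val x^-1 i = ((torus_val x i)^-1)%R.
Proof. by rewrite /inv /= ffunE. Qed.

(* G_m^r is the closed subset of K^(2r) with equations x_i y_i = 1. *)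
Definition split_torus_coord x : affine_space K (r + r) :=
  affine_pair (torus_val x : affine_space K r) (torus_val x^-1 : affine_space K r).

Fact split_torus_coord_inj : injective split_torus_coord.
Proof.
move=> x y exy; apply/val_inj/ffunP => i.
by have := congr1 (fun v : affine_space K _ => v (lshift r i)) exy;
  rewrite !affine_pairl.
Qed.

Fact split_torus_closed_coord : closed (range split_torus_coord).
Proof.
suff -> : range split_torus_coord = zero_locus
    [set p : mpoly (r + r) K | exists i : 'I_r,
       p = (mvar (lshift r i) * mvar (rshift r i) - 1)%R].
  exact: zero_locus_closed.
apply/seteqP; split => v /=.
  move=> [x _ <-] _ [i ->].
  rewrite mevalB mevalM !mevalXU meval1 affine_pairl affine_pairr.
  by rewrite /affine_coord split_torusV mulfV ?subrr ?split_torus_neq0.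
move=> v0.
have vE i : (v (lshift r i) * v (rshift r i))%R = 1%R.
  have /eqP := v0 _ (ex_intro _ i erefl).
  by rewrite mevalB mevalM !mevalXU meval1 subr_eq0 => /eqP.
have xP : [forall i, [ffun i => v (lshift r i)] i != 0%R].
  apply/forallP => i; rewrite ffunE; apply/eqP => vi0.
  by have /eqP := vE i; rewrite vi0 mul0r eq_sym oner_eq0.
exists (SplitTorus xP) => //; apply/ffunP => i.
case: (split_ordP i) => j ->; rewrite -![LHS]/(affine_coord _ _).
  by rewrite affine_pairl /affine_coord ffunE.
rewrite affine_pairr /affine_coord split_torusV ffunE.
by apply: (mulfI (forallP xP j)); rewrite ffunE mulfV ?vE //; have := forallP xP j;
  rewrite ffunE.
Qed.

Fact split_torus_mulg_polynomial :
  exists P : 'I_(r + r) -> mpoly ((r + r) + (r + r)) K, forall x y i,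
    split_torus_coord (x * y) i =
    meval (affine_pair (split_torus_coord x) (split_torus_coord y)) (P i).
Proof.
exists (fun i => mvar (lshift _ i) * mvar (rshift _ i))%R => x y i.
rewrite mevalM !mevalXU affine_pairl affine_pairr.
case: (split_ordP i) => j ->; rewrite ?affine_pairl ?affine_pairr /affine_coord.
  exact: split_torusM.
by rewrite !(split_torusM, split_torusV) invfM.
Qed.

Fact split_torus_invg_polynomial :
  exists P : 'I_(r + r) -> mpoly (r + r) K, forall x i,
    split_torus_coord x^-1 i = meval (split_torus_coord x) (P i).
Proof.
exists (fun i => match split i with
  inl j => mvar (rshift r j) | inr j => mvar (lshift r j) end)%R => x i.
case: (split_ordP i) => j ->; rewrite ?(unsplitK (inl _)) ?(unsplitK (inr _));
  rewrite mevalXU !(affine_pairl, affine_pairr) //.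
by rewrite invgK.
Qed.

HB.instance Definition _ := isAffineAlgGroup.Build K split_torus
  split_torus_coord_inj split_torus_closed_coord
  split_torus_mulg_polynomial split_torus_invg_polynomial.

End SplitTorus.

Section Torus.
Variables (K : fieldType) (G : affAlgGroupType K).

(* The closed subset range aff_coord carries the topology induced by the affine
   space, so connectedness in G is connectedness of the image under aff_coord. *)
Definition identity_component : set G :=
  (@aff_coord K G) @^-1`
    connected_component (range (@aff_coord K G)) (aff_coord (1 : G)).

(* S is a subgroup isomorphic, as an algebraic group, to some G_m^r: the maps u
   and v are mutually inverse morphisms between G_m^r and S. *)
Definition is_torus (S : set G) :=
  exists (r : nat) (u : split_torus K r -> G) (v : G -> split_torus K r),
    [/\ {morph u : x y / x * y},
        regular_map_on setT u,
        regular_map_on S v,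
        (forall x, S (u x) /\ v (u x) = x)
      & forall t, S t -> u (v t) = t].

End Torus.

Arguments identity_component {K} G.

(* The least positive n with P n, and 0 if there is none. *)
Definition least_positive (P : nat -> Prop) : nat :=
  xget 0%N [set n |
    [/\ (0 < n)%N, P n & forall k, (0 < k)%N -> P k -> (n <= k)%N]].

Section Orders.
Variable G : groupType.

Definition elt_order (x : G) : nat := least_positive (fun n => x ^+ n = 1).

Definition finite_order (x : G) := exists2 n, (0 < n)%N & x ^+ n = 1.

Definition periodic (C : set G) := forall x, C x -> finite_order x.

(* The order of a self-map f of S, in the group of bijections of S. *)
Definition aut_order (S : set G) (f : G -> G) : nat :=
  least_positive (fun n => forall t, S t -> iter n f t = t).

Definition left_coset (g : G) (T : set G) : set G := [set g * t | t in T].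

Definition set_mul (A B : set G) : set G :=
  [set z | exists x y, [/\ A x, B y & z = x * y]].

(* The order of a coset C in G/T, for T normal in G: cosets are multiplied as
   subsets of G and T is the identity of G/T. *)
Definition coset_order (T C : set G) : nat :=
  least_positive (fun n => iter n (set_mul C) T = T).

End Orders.

(* Main.v *)
(* Write phi for t |-> t ^ g and N n t for phi^(n-1)(t) ... phi(t) t, so that
   (g t)^n = g^n N n t.  Since phi^m = 1 on T, N (m j) = (N m)^j, so periodicity of
   gT makes N m a torsion-valued algebraic endomorphism of T.  Such a morphism is
   trivial: on a one-parameter subgroup with parameter x it is given by Laurent
   polynomials in x, constant on the infinitely many powers of 2^e where e is the
   order of its value at 2.  As g^k is in T and fixed by phi, N m (g^k) = 1 says
   g^(mk) = 1, whence (g t)^(mk) = g^(mk) (N m t)^k = 1. *)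
Require Import Defs.
From mathcomp Require Import all_boot all_algebra.
From mathcomp Require Import boolp classical_sets.
From mathcomp Require Import topology_structure connected subspace_topology.
From mathcomp Require Import -(notations) mpoly.

Set Implicit Arguments.
Unset Strict Implicit.
Unset Printing Implicit Defensive.

Import GRing.Theory.

(** * Least positive exponents and divisibility by the order *)

Section LeastPositive.
Local Open Scope nat_scope.

Lemma least_positiveP (P : nat -> Prop) : (exists2 n, 0 < n & P n) ->
  [/\ 0 < least_positive P, P (least_positive P) &
      forall n, 0 < n -> P n -> least_positive P <= n].
Proof.
move=> [n n0 Pn]; apply: (@xgetPex _ 0 [set i |
  [/\ 0 < i, P i & forall j, 0 < j -> P j -> i <= j]]%classic).
have exP : exists i, (0 < i) && `[< P i >] by exists n; rewrite n0; apply/asboolP.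
case: (ex_minnP exP) => i /andP[i0 /asboolP Pi] imin; exists i; split=> // j j0 Pj.
by apply: imin; rewrite j0; apply/asboolP.
Qed.

Lemma elt_order_dvdn (G : groupType) (x : G) n :
  (x ^+ n = 1)%g -> elt_order x %| n.
Proof.
(* For [n = 0] divisibility holds even when the order is the default 0. *)
have [->//|n0 xn] := posnP n.
have [o0 xo omin] :=
  least_positiveP (ex_intro2 _ (fun i => x ^+ i = 1)%g n n0 xn).
have xr : (x ^+ (n %% elt_order x) = 1)%g.
  by move: xn; rewrite {1}(divn_eq n (elt_order x)) mulnC expgnDr expgnA xo
    expg1n mul1g.
rewrite /dvdn; have [//|r0] := posnP (n %% elt_order x).
by have := omin _ r0 xr; rewrite leqNgt ltn_mod o0.
Qed.

End LeastPositive.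

(** * Algebras of functions and group-valued maps with coordinates in them *)

Section FunctionAlgebra.
Local Open Scope ring_scope.
Variables (K : fieldType) (X : Type).

(** Regular functions, polynomial functions and Laurent polynomials are all instances, so stability
    under the polynomial group law is proved once for the three. *)
Definition function_algebra (A : (X -> K) -> Prop) :=
  [/\ forall c, A (fun=> c),
      forall f h, A f -> A h -> A (fun x => f x + h x)
    & forall f h, A f -> A h -> A (fun x => f x * h x)].

Variables (A : (X -> K) -> Prop) (algA : function_algebra A).

Lemma function_algebra_meval n (f : 'I_n -> X -> K) (p : mpoly n K) :
  (forall i, A (f i)) -> A (fun x => meval (fun i => f i x) p).
Proof.
move=> Af; have [Ac AD AM] := algA.
have AX h d : A h -> A (fun x => h x ^+ d).
  move=> Ah; elim: d => [|d IHd]; first exact: Ac.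
  under eq_fun do rewrite exprS.
  by apply: AM.
under eq_fun do rewrite mevalE.
(* Induction on the list of monomials of [p], then for each monomial on the list of variables. *)
elim: (X in bigop.body _ X) => [|m s IHs].
  under eq_fun do rewrite big_nil.
  by apply: Ac.
under eq_fun do rewrite big_cons.
apply: AD => //; apply: (AM); first exact: Ac.
elim: (index_enum _) => [|i r IHr].
  under eq_fun do rewrite big_nil.
  by apply: Ac.
under eq_fun do rewrite big_cons.
by apply: AM => //; apply: AX.
Qed.

Variable G : affAlgGroupType K.
Implicit Types h : X -> G.

Definition coords_in h := forall i, A (fun x => aff_coord (h x) i).

Lemma coords_in_cst y : coords_in (fun=> y).
Proof. by move=> i; case: algA. Qed.

Lemma coords_inM h1 h2 : coords_in h1 -> coords_in h2 ->
  coords_in (fun x => h1 x * h2 x)%g.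
Proof.
move=> A1 A2 i; have [P PE] := @mulg_polynomial K G.
have Apair j : A (fun x => affine_pair (aff_coord (h1 x)) (aff_coord (h2 x)) j).
  case: (split_ordP j) => l ->.
    by under eq_fun do rewrite affine_pairl.
  by under eq_fun do rewrite affine_pairr.
under eq_fun do rewrite PE.
exact: (function_algebra_meval (P i) Apair).
Qed.

Lemma coords_inX h n : coords_in h -> coords_in (fun x => h x ^+ n)%g.
Proof.
move=> Ah; elim: n => [|n IHn]; first exact: coords_in_cst.
under eq_fun do rewrite expgS.
exact: coords_inM.
Qed.

End FunctionAlgebra.

(** * Zariski continuity and stability of the identity component *)

Section RegularFunctions.
Local Open Scope ring_scope.
Variable K : fieldType.

Lemma regular_on_algebra (G : affAlgGroupType K) (S : set G) :
  function_algebra (regular_on S).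
Proof.
split=> [c|f h [p pE] [q qE]|f h [p pE] [q qE]].
- by exists (mpolyC _ c) => x _; rewrite mevalC.
- by exists (p + q) => x Sx; rewrite mevalD pE ?qE.
- by exists (p * q) => x Sx; rewrite mevalM pE ?qE.
Qed.

Lemma polynomial_algebra n :
  function_algebra (fun f : affine_space K n -> K => exists p, forall v, f v = meval v p).
Proof.
split=> [c|f h [p pE] [q qE]|f h [p pE] [q qE]].
- by exists (mpolyC _ c) => v; rewrite mevalC.
- by exists (p + q) => v; rewrite mevalD pE qE.
- by exists (p * q) => v; rewrite mevalM pE qE.
Qed.

(** The preimage of the zero locus of [I] is the zero locus of the polynomials [p \o F] with [p] in
    [I]. *)
Lemma zariski_continuous m n (F : affine_space K m -> affine_space K n)
    (P : 'I_n -> mpoly m K) :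
  (forall v i, F v i = meval v (P i)) -> continuous F.
Proof.
move=> FE; apply/continuousP => _ [I ->].
exists [set q | exists2 p, I p & forall v : affine_space K m, meval v q = meval (F v) p]%classic.
apply/seteqP; split => v /= vI vJ; apply: vI.
  move=> p Ip.
  have [|q qE] := function_algebra_meval (polynomial_algebra m)
    (f := fun i v => F v i) p.
    by move=> i; exists (P i) => w; rewrite FE.
  by rewrite qE; apply: vJ; exists p.
by move=> q [p Ip ->]; exact: vJ.
Qed.

Variable G : affAlgGroupType K.

(** The image of the component is connected and contains 1, so maximality of the component
    applies. *)
Lemma identity_component_morph (f : G -> G) : f 1%g = 1%g ->
  regular_map_on setT f ->
  forall t, identity_component G t -> identity_component G (f t).
Proof.
move=> f1 /choice[P PE] t Tt.
(* The topology lives on the affine space, so [f] is extended to it by its polynomial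
   representatives. *)
pose F (v : affine_space K (@coord_dim K G)) : affine_space K (@coord_dim K G) :=
  [ffun i => meval v (P i)].
have FE v i : F v i = meval v (P i) by rewrite /affine_coord ffunE.
have Ff x : F (aff_coord x) = aff_coord (f x).
  by apply/ffunP => i; rewrite -![LHS]/(affine_coord _ _) FE -PE.
rewrite /identity_component /=.
have D1 : range (@aff_coord K G) (aff_coord (1 : G)%g) by exists 1%g.
apply: (@connected_component_max _ _
  (F @` connected_component (range (@aff_coord K G)) (aff_coord (1 : G)%g))%classic).
- exists (aff_coord (1 : G)%g); last by rewrite Ff f1.
  exact: connected_component_refl.
- by move=> _ [v /connected_component_sub[x _ <-] <-]; exists (f x); rewrite // Ff.
- apply: connected_continuous_connected; first exact: component_connected.
  by apply: continuous_subspaceT; apply: zariski_continuous FE.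
- by exists (aff_coord t); rewrite // Ff.
Qed.

Lemma regular_map_id : regular_map_on setT (@id G).
Proof. by move=> i; exists (mpolyX _ (mnm1 i)) => x _; rewrite mevalXU. Qed.

Lemma identity_component_conjg (g t : G) :
  identity_component G t -> identity_component G (t ^ g)%g.
Proof.
apply: (identity_component_morph (f := fun t => t ^ g)%g); first exact: conj1g.
have algR := @regular_on_algebra G setT.
apply: (coords_inM algR); first exact: coords_in_cst.
by apply: (coords_inM algR); [exact: regular_map_id | exact: coords_in_cst].
Qed.

End RegularFunctions.

(** * Laurent polynomials in one variable *)

Section Laurent.
Local Open Scope ring_scope.
Variable K : fieldType.

(** The factor [x ^+ d] clears the denominator; the value of [f] at 0 is left free. *)
Definition laurent (f : K -> K) :=
  exists (p : {poly K}) (d : nat), forall x, x != 0 -> f x * x ^+ d = p.[x].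

Lemma laurent_algebra : function_algebra laurent.
Proof.
split=> [c|f h [p [d pE]] [q [e qE]]|f h [p [d pE]] [q [e qE]]].
- by exists c%:P, 0%N => x _; rewrite hornerC mulr1.
- exists (p * 'X^e + q * 'X^d), (d + e)%N => x x0.
  rewrite hornerD !hornerM !hornerXn -pE // -qE // mulrDl exprD.
  by rewrite mulrA (mulrC (x ^+ d)) mulrA.
- exists (p * q), (d + e)%N => x x0.
  by rewrite hornerM -pE // -qE // exprD mulrACA.
Qed.

Hypothesis charK : [pchar K] =i pred0.

Lemma pchar0_natr_inj : injective (fun n => n%:R : K).
Proof.
move=> i j; wlog ij : i j / (i <= j)%N.
  by move=> H; have [/H//|/ltnW/H H' /esym/H' ->] := leqP i j.
move=> /eqP; rewrite eq_sym -subr_eq0 -natrB // ((pcharf0P K).1 charK) subn_eq0 => ji.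
by apply/eqP; rewrite eqn_leq ij.
Qed.

Lemma pchar0_exp2_inj : injective (fun n => 2%:R ^+ n : K).
Proof.
by move=> i j; rewrite -!natrX => /pchar0_natr_inj/eqP; rewrite eqn_exp2l // => /eqP.
Qed.

Lemma laurent_cst (f : K -> K) (a c : K) : laurent f ->
  a != 0 -> injective (fun n => a ^+ n) -> (forall n, f (a ^+ n) = c) ->
  forall x, x != 0 -> f x = c.
Proof.
move=> [p [d pE]] a0 a_inj fa x x0.
have qE y : y != 0 -> (p - c *: 'X^d).[y] = (f y - c) * y ^+ d.
  by move=> y0; rewrite hornerD hornerN hornerZ hornerXn mulrBl pE.
have [q0|q0] := eqVneq (p - c *: 'X^d) 0.
  have /esym/eqP := qE x x0.
  by rewrite q0 horner0 mulf_eq0 expf_eq0 (negbTE x0) andbF orbF subr_eq0 => /eqP.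
(* A nonzero polynomial has fewer roots than its size, yet this list gives as many distinct roots as
   the size. *)
have := max_poly_roots q0 (rs := mkseq (fun n => a ^+ n) (size (p - c *: 'X^d))).
rewrite size_mkseq ltnn; case/(_ _ _)/negP; rewrite ?mkseq_uniq //.
apply/allP => _ /mapP[n _ ->].
by rewrite /root qE ?expf_neq0 // fa subrr mul0r.
Qed.

End Laurent.

(** * Torsion-valued morphisms from a torus are trivial *)

Section TorusMorphisms.
Local Open Scope ring_scope.
Variable K : fieldType.
Hypothesis charK : [pchar K] =i pred0.

Lemma laurent_morph_trivial (G : affAlgGroupType K) (h : K -> G) :
  coords_in (@laurent K) h ->
  (forall x y, x != 0 -> y != 0 -> h (x * y) = (h x * h y)%g) ->
  (forall x, x != 0 -> finite_order (h x)) ->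
  forall x, x != 0 -> h x = 1%g.
Proof.
move=> Lh hM h_fin x x0.
have K2 : 2%:R != 0 :> K by rewrite ((pcharf0P K).1 charK).
have h1 : h 1 = 1%g.
  by apply: (mulgI (h 1)); rewrite mulg1 -hM ?oner_neq0 // mulr1.
have hX y n : y != 0 -> h (y ^+ n) = (h y ^+ n)%g.
  by move=> y0; elim: n => // n IHn; rewrite exprS expgS hM ?expf_neq0 ?IHn.
have [e e0 h2e] := h_fin _ K2.
apply: (@coord_inj K G); apply/ffunP => i.
(* Since [h 2 ^+ e = 1], [h] is trivial at every power of [2 ^+ e], and characteristic zero makes
   these powers distinct. *)
apply: (laurent_cst (Lh i) (a := 2%:R ^+ e)) => //; first by rewrite expf_neq0.
  move=> m n /=; rewrite -!exprM => /(pchar0_exp2_inj charK)/eqP.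
  by rewrite eqn_pmul2l // => /eqP.
by move=> n; rewrite !hX ?expf_neq0 // h2e expg1n.
Qed.

Section OneParameter.
Variable r : nat.

Fact one_param_subproof (j : 'I_r) (x : K) :
  [forall i, [ffun i => if (i == j) && (x != 0) then x else 1] i != 0].
Proof.
apply/forallP => i; rewrite ffunE.
by case: ifP => [/andP[]|] //; rewrite oner_neq0.
Qed.

(* At the junk value x = 0 this is the identity of the torus. *)
Definition one_param j x : split_torus K r := SplitTorus (one_param_subproof j x).

Lemma one_paramE j x i : x != 0 ->
  torus_val (one_param j x) i = if i == j then x else 1.
Proof. by move=> x0; rewrite ffunE x0 andbT. Qed.

Lemma one_paramM j x y : x != 0 -> y != 0 ->
  one_param j (x * y) = (one_param j x * one_param j y)%g.
Proof.
move=> x0 y0; apply/val_inj/ffunP => i.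
rewrite [RHS]split_torusM !one_paramE ?mulf_neq0 //.
by case: ifP; rewrite ?mulr1.
Qed.

Lemma laurent_one_param j : coords_in (@laurent K) (one_param j).
Proof.
move=> i; case: (split_ordP i) => l ->.
  exists (if l == j then 'X else 1), 0%N => x x0.
  rewrite [X in X * _]affine_pairl [X in X * _]one_paramE // mulr1.
  by case: ifP; rewrite ?hornerX ?hornerC.
(* The last [r] coordinates are the inverses, so [x^-1] occurs and one factor [x] clears it. *)
exists (if l == j then 1 else 'X), 1%N => x x0.
rewrite [X in X * _]affine_pairr [X in X * _]split_torusV one_paramE //.
by case: ifP; rewrite ?hornerX ?hornerC ?invr1 ?mul1r // mulVf.
Qed.

Lemma prod_one_param (t : split_torus K r) :
  t = (\prod_(j < r) one_param j (torus_val t j))%g.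
Proof.
apply/val_inj/ffunP => i.
rewrite [RHS](big_morph (fun z => torus_val z i) (id1 := 1) (op1 := *%R)).
- rewrite (bigD1 i) //= big1 => [|j ji].
    by rewrite mulr1 one_paramE ?split_torus_neq0 ?eqxx.
  by rewrite one_paramE ?split_torus_neq0 // eq_sym (negbTE ji).
- by move=> x y; exact: split_torusM.
- by rewrite ffunE.
Qed.

(** The one-parameter subgroups generate the torus, and along each of them [f] has Laurent
    polynomial coordinates. *)
Lemma torsion_torus_morph_trivial (G : affAlgGroupType K) (f : split_torus K r -> G) :
  {morph f : x y / x * y}%g -> regular_map_on setT f ->
  (forall t, finite_order (f t)) -> forall t, f t = 1%g.
Proof.
move=> fM f_reg f_fin t.
have f1 : f 1%g = 1%g by apply: (mulgI (f 1%g)); rewrite -fM !mulg1.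
rewrite (prod_one_param t) (big_morph f fM f1) big1 // => j _.
apply: (laurent_morph_trivial (h := fun x => f (one_param j x))) => //.
- move=> i; have [p pE] := f_reg i.
  under eq_fun do rewrite pE //.
  apply: (function_algebra_meval (@laurent_algebra K)) => l.
  exact: laurent_one_param.
- by move=> x y x0 y0; rewrite one_paramM ?fM.
- exact: split_torus_neq0.
Qed.

End OneParameter.
End TorusMorphisms.

(** * Twisted powers and powers of the coset *)

Section TwistedPower.
Local Open Scope group_scope.
Variables (G : groupType) (g : G).
Implicit Types (s t : G) (m n : nat).

(* With phi t = t ^ g this is phi^(n-1)(t) ... phi(t) t. *)
Definition twisted_pow n t := g ^- n * (g * t) ^+ n.

Lemma twisted_powE n t : (g * t) ^+ n = g ^+ n * twisted_pow n t.
Proof. by rewrite mulVKg. Qed.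

(** The cocycle identity: insert [g ^+ n * g ^- n] between [(g * t) ^+ m] and [(g * t) ^+ n]. *)
Lemma twisted_powD m n t :
  twisted_pow (m + n) t = twisted_pow m t ^ (g ^+ n) * twisted_pow n t.
Proof. by rewrite /twisted_pow conjgE !expgnDr invgM !mulgA !mulgK. Qed.

Lemma twisted_pow0 t : twisted_pow 0 t = 1.
Proof. by rewrite /twisted_pow !expg0 mulg1 invg1. Qed.

Lemma twisted_powSr n t : twisted_pow n.+1 t = twisted_pow n t ^ g * t.
Proof. by rewrite -addn1 twisted_powD /twisted_pow expg1 mulKg. Qed.

Lemma twisted_pow_fixed n s : s ^ g = s -> twisted_pow n s = s ^+ n.
Proof.
move=> sg; elim: n => [|n IHn]; first by rewrite twisted_pow0.
by rewrite twisted_powSr IHn conjXg sg expgSr.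
Qed.

Lemma iter_conjg n t : iter n (conjg^~ g) t = t ^ (g ^+ n).
Proof.
by elim: n => [|n IHn]; rewrite ?conjg1 // iterS IHn expgSr conjgM.
Qed.

Variable T : set G.
Hypotheses (T1 : T 1) (TM : forall s t, T s -> T t -> T (s * t)).
Hypothesis TJ : forall t, T t -> T (t ^ g).

Lemma iter_coset n :
  iter n (set_mul (left_coset g T)) T = left_coset (g ^+ n) T.
Proof.
elim: n => [|n IHn].
  apply/seteqP; split=> [t Tt|_ [t Tt <-]]; last by rewrite mul1g.
  by exists t; rewrite ?mul1g.
rewrite iterS IHn; apply/seteqP; split=> z.
  (* Moving [s] to the right across [g ^+ n] conjugates it, and [T] is stable under this. *)
  move=> [_ [_ [[s Ts <-] [t Tt <-] ->]]]; exists (s ^ (g ^+ n) * t).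
    by apply: TM => //; rewrite -iter_conjg; elim: (n) => //= i; exact: TJ.
  by rewrite conjgE expgS !mulgA mulgK.
move=> [t Tt <-]; exists g, (g ^+ n * t); split; last by rewrite mulgA -expgS.
  by exists 1; rewrite ?mulg1.
by exists t.
Qed.

Hypothesis TC : forall s t, T s -> T t -> s * t = t * s.

Lemma twisted_pow_closed n t : T t -> T (twisted_pow n t).
Proof.
move=> Tt; elim: n => [|n IHn].
  by rewrite twisted_pow0.
by rewrite twisted_powSr; apply: TM => //; apply: TJ.
Qed.

Lemma twisted_powM n s t : T s -> T t ->
  twisted_pow n (s * t) = twisted_pow n s * twisted_pow n t.
Proof.
move=> Ts Tt; elim: n => [|n IHn].
  by rewrite !twisted_pow0 mulg1.
rewrite !twisted_powSr IHn conjMg.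
have := TJ (twisted_pow_closed n Tt).
move: (twisted_pow n s ^ g) (twisted_pow n t ^ g) => a b Tb.
by rewrite !mulgA -(mulgA a b) (TC Tb Ts) mulgA.
Qed.

(** Conjugation by [g ^+ m] fixes [T], so the cocycle identity loses its twist. *)
Lemma twisted_pow_exp m j t : (forall s, T s -> s ^ (g ^+ m) = s) -> T t ->
  twisted_pow (m * j) t = twisted_pow m t ^+ j.
Proof.
move=> mT Tt; elim: j => [|j IHj].
  by rewrite muln0 twisted_pow0.
rewrite mulnSr twisted_powD mT; last exact: twisted_pow_closed.
by rewrite IHj expgSr.
Qed.

Lemma twisted_pow_finite_order m t : (forall s, T s -> s ^ (g ^+ m) = s) ->
  periodic (left_coset g T) -> T t -> finite_order (twisted_pow m t).
Proof.
move=> mT gT Tt.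
have [|n n0 gtn] := gT (g * t); first by exists t.
have [|e e0 ge] := gT g; first by exists 1; rewrite ?mulg1.
(* This exponent is a multiple of [n], which kills [g * t], and of [e], which kills [g]. *)
exists (n * e)%N; first by rewrite muln_gt0 n0.
have gE : g ^+ (m * (n * e)) = 1 by rewrite mulnA mulnC expgnA ge expg1n.
have gtE : (g * t) ^+ (m * (n * e)) = 1 by rewrite mulnCA expgnA gtn expg1n.
by rewrite -twisted_pow_exp // /twisted_pow gE gtE mulg1 invg1.
Qed.

End TwistedPower.

Theorem corollary5 (K : closedFieldType) (charK : [pchar K]%R =i pred0)
    (G : affAlgGroupType K) (g : G)
    (torusT : is_torus (identity_component G))
    (periodic_gT : periodic (left_coset g (identity_component G))) :
  let T := identity_component G in
  let m := aut_order T (fun t : G => (t ^ g)%g) in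
  let k := coset_order T (left_coset g T) in
  [/\ (0 < m)%N, (0 < k)%N &
      forall x : G, left_coset g T x -> (elt_order x %| m * k)%N].
Proof.
move=> T m k.
have [r [u [v [uM u_reg _ uT vK]]]] := torusT.
have TM s t : T s -> T t -> T (s * t)%g.
  by move=> /vK <- /vK <-; rewrite -uM; case: (uT (v s * v t)%g).
have TC s t : T s -> T t -> (s * t = t * s)%g.
  move=> /vK <- /vK <-; rewrite -!uM; congr u.
  by apply/val_inj/ffunP => i; rewrite [LHS]split_torusM [RHS]split_torusM mulrC.
have T1 : T 1%g.
  have u1 : u 1%g = 1%g by apply: (mulgI (u 1%g)); rewrite -uM !mulg1.
  by rewrite -u1; case: (uT 1%g).
have TJ t : T t -> T (t ^ g)%g by exact: identity_component_conjg.
(* [g] itself lies in the coset; [g ^+ n = 1] shows that [m] and [k] are genuine orders and not the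
   default 0. *)
have [|n n0 gn] := periodic_gT g; first by exists 1%g; rewrite ?mulg1.
have [|m0 mT _] := @least_positiveP
  (fun i => forall t, T t -> iter i (fun t : G => t ^ g)%g t = t).
  by exists n => // t _; rewrite iter_conjg gn conjg1.
have {}mT t : T t -> (t ^ (g ^+ m) = t)%g by move=> /mT; rewrite iter_conjg.
have [|k0 kT _] := @least_positiveP
  (fun i => iter i (set_mul (left_coset g T)) T = T).
  exists n => //.
  (* With [T] as the zeroth iterate, both sides become the coset of 1. *)
  by rewrite -[RHS]/(iter 0 (set_mul (left_coset g T)) T) !iter_coset // gn.
have Tgk : T (g ^+ k)%g.
  by rewrite -kT iter_coset //; exists 1%g; rewrite ?mulg1.
have N1 t : T t -> twisted_pow g m t = 1%g.
  (* Precomposing with [u] gives a morphism defined on the split torus. *)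
  move=> /vK <-; apply: (torsion_torus_morph_trivial charK
    (f := fun z => twisted_pow g m (u z))).
  - move=> x y; rewrite uM; apply: (twisted_powM T1) => //; by [case: (uT x) | case: (uT y)].
  - have algR := @regular_on_algebra K (split_torus K r) setT.
    apply: (coords_inM algR); first exact: coords_in_cst.
    by apply: (coords_inX algR); apply: (coords_inM algR) => //; exact: coords_in_cst.
  - by move=> z; apply: (twisted_pow_finite_order T1) => //; case: (uT z).
split=> // _ [t Tt <-]; apply: elt_order_dvdn.
rewrite twisted_powE (twisted_pow_exp T1) // N1 // expg1n mulg1.
(* [g ^+ k] commutes with [g], so its [m]-th power is its twisted power, which is 1 because [g ^+ k]
   is in [T]. *)
rewrite mulnC expgnA -(twisted_pow_fixed (g := g)) ?N1 //.
by rewrite conjXg conjgE mulKg.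
Qed.
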